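(* (i) Let $k\geq 3$ be an integer. There are no integers $n,m,t$ with $2\leq m<n=t+2$ and $F_n^{(k)}+F_m^{(k)}=2^t$ such that either $(n,m)\in[2,k+1]^2$ or $(n,m)\in[k+2,2k+2]^2$. (ii) For every integer $s\geq 1$ and every integer $k\geq 2$ with $k\geq 2^s+s-2$, the quadruple $(n,m,t,k)=(2^s+k,\,2^s+s-1,\,2^s+k-2,\,k)$ satisfies $F_n^{(k)}+F_m^{(k)}=2^t$, with $2\leq m\leq k+1$, $k+2\leq n\leq 2k+2$, and $n=t+2$.
   Context: For an integer $k\geq 2$, the $k$-generalized Fibonacci sequence $(F_n^{(k)})_{n\geq -(k-2)}$ is defined by $F_{-(k-2)}^{(k)}=\cdots=F_0^{(k)}=0$, $F_1^{(k)}=1$, and $F_{n+k}^{(k)}=F_{n+k-1}^{(k)}+\cdots+F_n^{(k)}$ for all $n\geq -(k-2)$. For integers $a<b$, $[a,b]$ denotes $\{a,a+1,\ldots,b\}$. *)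

(* Defs.v *)
From mathcomp Require Import all_boot all_order all_algebra.
From mathcomp Require Import zify.

Set Implicit Arguments.
Unset Strict Implicit.
Unset Printing Implicit Defensive.

Import Order.TTheory GRing.Theory Num.Theory.
Local Open Scope ring_scope.

(* The k consecutive terms F_{j-(k-2)}, ..., F_{j+1} of the k-generalized
   Fibonacci sequence, so that j = 0 gives the initial values 0, ..., 0, 1. *)
Fixpoint gfib_window (k j : nat) : seq nat :=
  if j is i.+1 then
    let w := gfib_window k i in rcons (behead w) (sumn w)
  else rcons (nseq k.-1 0%N) 1%N.

(* F_n^(k), for n >= -(k-2); the value is 0 by convention for smaller n.
   [gfib_init0], [gfib1] and [gfib_rec] below are the defining equations. *)
Definition gfib (k : nat) (n : int) : int :=
  if n + k%:Z - 2 is Posz j then (head 0%N (gfib_window k j))%:Z else 0.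

Lemma size_gfib_window k j : (0 < k)%N -> size (gfib_window k j) = k.
Proof.
move=> k0; elim: j => [|j IH] /=.
  by rewrite size_rcons size_nseq prednK.
by rewrite size_rcons size_behead IH prednK.
Qed.

Lemma nth_gfib_window k j i : (i < k)%N ->
  nth 0%N (gfib_window k j) i = head 0%N (gfib_window k (j + i)).
Proof.
move=> ik; have k0 : (0 < k)%N by apply: leq_ltn_trans ik.
elim: i j ik => [|i IH] j ik; first by rewrite addn0 nth0.
rewrite addnS -addSn -IH; last exact: ltnW.
rewrite /= nth_rcons size_behead size_gfib_window // nth_behead.
by rewrite -ltnS prednK // ik.
Qed.

Lemma gfibE (k j : nat) :
  gfib k (j%:Z - k%:Z + 2) = (head 0%N (gfib_window k j))%:Z.
Proof. by rewrite /gfib; have -> : j%:Z - k%:Z + 2 + k%:Z - 2 = j by lia. Qed.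

Lemma gfib_init0 (k : nat) (n : int) :
  (2 <= k)%N -> - (k%:Z - 2) <= n <= 0 -> gfib k n = 0.
Proof.
move=> k2 /andP[n1 n0].
have [j Dj] : exists j : nat, n = j%:Z - k%:Z + 2.
  by exists `|(n + k%:Z - 2)%R|%N; lia.
have jk : (j < k.-1)%N by lia.
have k0 : (0 < k)%N by apply: ltnW.
rewrite Dj gfibE -[j]add0n -nth_gfib_window /=; last first.
  exact: leq_trans jk (leq_pred k).
by rewrite nth_rcons size_nseq jk nth_nseq jk.
Qed.

Lemma gfib1 (k : nat) : (2 <= k)%N -> gfib k 1 = 1.
Proof.
case: k => [|[|k]] // _.
have e : (k.+1)%:Z - (k.+2)%:Z + 2 = 1 by lia.
rewrite -[X in gfib _ X]e gfibE -[k.+1]add0n -nth_gfib_window //.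
by rewrite nth_rcons size_nseq ltnn eqxx.
Qed.

Lemma gfib_rec (k : nat) (n : int) : (2 <= k)%N -> - (k%:Z - 2) <= n ->
  gfib k (n + k%:Z) = \sum_(i < k) gfib k (n + i%:Z).
Proof.
move=> k2 n1; have k0 : (0 < k)%N by apply: ltnW.
have [j ->] : exists j : nat, n = j%:Z - k%:Z + 2.
  by exists `|(n + k%:Z - 2)%R|%N; lia.
have D i : j%:Z - k%:Z + 2 + i%:Z = (j + i)%N%:Z - k%:Z + 2.
  by lia.
rewrite D gfibE.
under eq_bigr => i _ do rewrite D gfibE -nth_gfib_window //.
rewrite -[in LHS](prednK k0) addnS -addSn -nth_gfib_window ?prednK //=.
rewrite nth_rcons size_behead size_gfib_window // ltnn eqxx.
rewrite sumnE (big_nth 0%N) size_gfib_window // big_mkord.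
exact: (big_morph Posz PoszD).
Qed.

(* Main.v *)
Require Import Defs.
From mathcomp Require Import all_boot all_order all_algebra.
From mathcomp Require Import zify ring.

Set Implicit Arguments.
Unset Strict Implicit.
Unset Printing Implicit Defensive.

Import Order.TTheory GRing.Theory Num.Theory.
Local Open Scope ring_scope.

(** Subtracting consecutive instances of the recurrence gives
    F_(n+1) = 2 F_n - F_(n-k), whence F_n = 2^(n-2) on [2, k+1] and
    F_n = 2^(n-2) - (n-k) 2^(n-k-3) on [k+2, 2k+2].  If n - k = 2^s, the
    correction term of F_n is 2^(m-2) = F_m for m = 2^s + s - 1, which is part
    (ii).  In part (i), two indices in the first range give F_n = 2^t already.
    In the second range, with a = m - k and d = n - m, the equation reads
    a + (a + d) 2^d = 2^(k+1); hence a = c 2^d and c + a + d = 2^(k+1-d),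
    which is at least 2^(a-1) since a + d <= k + 2.  As c + d < a unless
    c = d = 1, this gives 2^a < 4a, so a < 4; hence c = d = 1 in any case, and
    k = 2. *)

Lemma int_ge_ind (a : int) (P : int -> Prop) :
  P a -> (forall n, a <= n -> P n -> P (n + 1)) -> forall n, a <= n -> P n.
Proof.
move=> Pa PS n; rewrite -subr_ge0 -[n in P n](subrK a).
case: (n - a) => // i _; elim: i => [|i IH]; first by rewrite add0r.
have -> : i.+1%:Z + a = i%:Z + a + 1 by lia.
by apply: PS => //; lia.
Qed.

Lemma exprzSr_ge0 (R : unitRingType) (x : R) (n : int) :
  0 <= n -> x ^ (n + 1) = x ^ n * x.
Proof. by move=> n_ge0; rewrite exprzD_ss ?n_ge0 // expr1z. Qed.

Lemma leq_mul4_exp2 (a : nat) : (4 <= a -> 4 * a <= 2 ^ a)%N.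
Proof.
elim: a => // a IH; rewrite leq_eqVlt => /predU1P[<- //|a_ge4].
by rewrite expnS; have := IH a_ge4; lia.
Qed.

Lemma add_mul_exp2_eq_exp2 (a d N : nat) :
    (0 < a)%N -> (0 < d)%N -> (a + d <= N.+1)%N ->
    (a + (a + d) * 2 ^ d = 2 ^ N)%N ->
  [/\ a = 2, d = 1 & N = 3].
Proof.
move=> a_gt0 d_gt0 ad_le sumE.
have /dvdnP[c a_eq] : (2 ^ d %| a)%N.
  rewrite -(dvdn_addl _ (dvdn_mull (a + d) (dvdnn (2 ^ d)))) sumE.
  by rewrite dvdn_exp2l //; lia.
have d_le : (2 * d <= 2 ^ d)%N.
  by rewrite -(prednK d_gt0) expnS leq_pmul2l // ltn_expl.
have quotE : (c + a + d = 2 ^ (N - d))%N.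
  apply/eqP; rewrite -(eqn_pmul2r (expn_gt0 2 d)) -expnD subnK; last by lia.
  by rewrite -sumE !mulnDl -a_eq addnA.
have c_gt0 : (0 < c)%N by case: c a_eq {quotE} => //; lia.
have exp_le : (2 ^ a <= 2 * (c + a + d))%N.
  by rewrite quotE -expnS leq_exp2l //; lia.
have a_lt4 : (a < 4)%N.
  rewrite ltnNge; apply/negP => a_ge4; have := leq_mul4_exp2 a_ge4.
  have cd_lt : (c + d < a)%N by nia.
  by lia.
have [c_eq1 d_eq1] : c = 1 /\ d = 1 by nia.
have : (2 ^ (N - d) == 2 ^ 2)%N by rewrite -quotE a_eq c_eq1 d_eq1.
rewrite eqn_exp2l // => /eqP N_eq.
by split; rewrite ?a_eq ?c_eq1 ?d_eq1 //; lia.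
Qed.

Section GeneralizedFibonacci.

Variable k : nat.
Hypothesis k_ge2 : (2 <= k)%N.

Lemma gfib2 : gfib k 2 = 1.
Proof.
case: k k_ge2 => [//|l] l_ge1; have := @gfib_rec l.+1 (2 - l.+1%:Z) l_ge1.
rewrite subrK big_ord_recr /= => ->; last by lia.
have -> : 2 - l.+1%:Z + l%:Z = 1 by lia.
rewrite gfib1 // big1 ?add0r // => i _.
by apply: gfib_init0 => //; have := ltn_ord i; lia.
Qed.

Lemma gfib_succ (n : int) :
  2 <= n -> gfib k (n + 1) = 2 * gfib k n - gfib k (n - k%:Z).
Proof.
case: k k_ge2 => [//|l] l_ge1 n_ge2.
pose common := \sum_(i < l) gfib l.+1 (n - l%:Z + i%:Z).
have recS : gfib l.+1 (n + 1) = common + gfib l.+1 n.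
  have := @gfib_rec l.+1 (n - l%:Z) l_ge1.
  have -> : n - l%:Z + l.+1%:Z = n + 1 by lia.
  by rewrite big_ord_recr /= subrK; apply; lia.
have rec : gfib l.+1 n = gfib l.+1 (n - l.+1%:Z) + common.
  have := @gfib_rec l.+1 (n - l.+1%:Z) l_ge1.
  rewrite subrK big_ord_recl addr0 => ->; last by lia.
  by congr (_ + _); apply: eq_bigr => i _; congr gfib; rewrite lift0; lia.
by rewrite recS [in 2 * _]rec [in LHS]rec; ring.
Qed.

Lemma gfib_eq_exp2 (n : int) :
  2 <= n <= k%:Z + 1 -> gfib k n = 2 ^ (n - 2).
Proof.
case/andP; move: n; apply: int_ge_ind => [|n n_ge2 IH] n_le.
  by rewrite gfib2.
rewrite gfib_succ // IH ?gfib_init0; try lia.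
have -> : n + 1 - 2 = n - 2 + 1 by lia.
by rewrite exprzSr_ge0; [ring | lia].
Qed.

(* Doubled because the correction term (n - k) 2^(n-k-3) has a negative
   exponent at n = k + 2. *)
Lemma double_gfib (n : int) : k%:Z + 2 <= n <= 2 * k%:Z + 2 ->
  2 * gfib k n = 2 ^ (n - 1) - (n - k%:Z) * 2 ^ (n - k%:Z - 2).
Proof.
case/andP; move: n; apply: int_ge_ind => [|n n_ge IH] n_le.
  have -> : k%:Z + 2 = k%:Z + 1 + 1 by lia.
  rewrite gfib_succ; last by lia.
  have -> : k%:Z + 1 - k%:Z = 1 by lia.
  rewrite gfib1 // gfib_eq_exp2; last by lia.
  have -> : k%:Z + 1 + 1 - k%:Z - 2 = 0 by lia.
  have -> : k%:Z + 1 + 1 - 1 = k%:Z + 1 - 2 + 1 + 1 by lia.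
  by rewrite expr0z !exprzSr_ge0; [ring | lia | lia].
rewrite gfib_succ ?mulrBr ?IH ?gfib_eq_exp2; try lia.
have -> : n + 1 - 1 = n - 1 + 1 by lia.
have -> : n + 1 - k%:Z - 2 = n - k%:Z - 2 + 1 by lia.
by rewrite !exprzSr_ge0; [ring | lia | lia].
Qed.

Lemma gfib_add_neq_exp2 (m t : int) :
    2 <= t + 2 <= k%:Z + 1 -> 2 <= m <= k%:Z + 1 ->
  gfib k (t + 2) + gfib k m != 2 ^ t.
Proof.
move=> t_in m_in; rewrite !gfib_eq_exp2 // addrK.
by rewrite -subr_eq0 addrC addKr expfz_neq0.
Qed.

Lemma gfib_add_eq_exp2_reduced (m t : int) :
    k%:Z + 2 <= t + 2 <= 2 * k%:Z + 2 -> k%:Z + 2 <= m <= t + 2 ->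
    gfib k (t + 2) + gfib k m = 2 ^ t ->
  m - k%:Z + (t + 2 - k%:Z) * 2 ^ (t + 2 - m) = 2 ^ k.+1.
Proof.
move=> t_in m_in sumE; pose p : int := 2 ^ (m - k%:Z - 2).
have correctionE :
    (m - k%:Z) * p + (t + 2 - k%:Z) * 2 ^ (t + 2 - k%:Z - 2) = 2 ^ (m - 1).
  have double_m : 2 * gfib k m = 2 ^ (m - 1) - (m - k%:Z) * p.
    by rewrite double_gfib //; lia.
  have := double_gfib t_in.
  have -> : t + 2 - 1 = t + 1 by lia.
  by rewrite exprzSr_ge0 -?sumE; lia.
have tE : 2 ^ (t + 2 - k%:Z - 2) = p * 2 ^ (t + 2 - m).
  by rewrite -exprzD_ss; [congr exprz; lia | lia].
have mE : 2 ^ (m - 1) = p * 2 ^ k.+1.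
  by rewrite -exprzD_ss; [congr exprz; lia | lia].
have p_neq0 : p != 0 by rewrite expfz_neq0.
by apply: (mulfI p_neq0); rewrite -mE -correctionE tE; ring.
Qed.

Lemma gfib_add_eq_exp2_unique (m t : int) :
    k%:Z + 2 <= t + 2 <= 2 * k%:Z + 2 -> k%:Z + 2 <= m < t + 2 ->
    gfib k (t + 2) + gfib k m = 2 ^ t ->
  [/\ k = 2, m = 4 & t = 3].
Proof.
move=> t_in m_in sumE.
have m_in_le : k%:Z + 2 <= m <= t + 2 by lia.
have reducedE := gfib_add_eq_exp2_reduced t_in m_in_le sumE.
have [a m_eq] : exists a : nat, m - k%:Z = a%:Z.
  by exists `|(m - k%:Z)%R|%N; lia.
have [d t_eq] : exists d : nat, t + 2 - m = d%:Z.
  by exists `|(t + 2 - m)%R|%N; lia.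
have natE : (a + (a + d) * 2 ^ d = 2 ^ k.+1)%N.
  apply/eqP; rewrite -eqz_nat PoszD PoszM PoszD -!natz !natrX !natz.
  rewrite !exprnP -reducedE m_eq t_eq; apply/eqP; congr (_ + _ * _); lia.
have [] : [/\ a = 2, d = 1 & k.+1 = 3].
  by apply: add_mul_exp2_eq_exp2 natE; lia.
by move=> a_eq d_eq [k_eq]; split=> //; lia.
Qed.

Lemma gfib_add_eq_exp2_family (s : nat) (n m : int) :
    n = 2 ^+ s + k%:Z -> m = 2 ^+ s + s%:Z - 1 ->
    k%:Z + 2 <= n <= 2 * k%:Z + 2 -> 2 <= m <= k%:Z + 1 ->
  gfib k n + gfib k m = 2 ^ (n - 2).
Proof.
move=> n_eq m_eq n_in m_in; apply: (@mulfI _ 2) => //.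
rewrite mulrDr double_gfib // gfib_eq_exp2 //.
have correctionE : (n - k%:Z) * 2 ^ (n - k%:Z - 2) = 2 * 2 ^ (m - 2) :> int.
  rewrite [in X in X * _]n_eq addrK exprnP -exprzD_ss; last by lia.
  by rewrite mulrC -exprzSr_ge0; [congr exprz; lia | lia].
have -> : n - 1 = n - 2 + 1 by lia.
by rewrite correctionE subrK exprzSr_ge0 1?mulrC; lia.
Qed.

End GeneralizedFibonacci.

Theorem theorem2 :
  (forall k : nat, (3 <= k)%N ->
     ~ exists n m t : int,
       [/\ 2 <= m < n,
           n = t + 2,
           gfib k n + gfib k m = 2 ^ t
         & (n \in `[2, k%:Z + 1] /\ m \in `[2, k%:Z + 1]) \/
           (n \in `[k%:Z + 2, 2 * k%:Z + 2] /\
            m \in `[k%:Z + 2, 2 * k%:Z + 2])])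
  /\
  (forall s k : nat, (1 <= s)%N -> (2 <= k)%N ->
     2 ^+ s + s%:Z - 2 <= k%:Z ->
     let n : int := 2 ^+ s + k%:Z in
     let m : int := 2 ^+ s + s%:Z - 1 in
     let t : int := 2 ^+ s + k%:Z - 2 in
     [/\ gfib k n + gfib k m = 2 ^ t,
         2 <= m <= k%:Z + 1,
         k%:Z + 2 <= n <= 2 * k%:Z + 2
       & n = t + 2]).
Proof.
split=> [k k_ge3 [n [m [t [m_in n_eq]]]]|s k s_ge1 k_ge2 s_le n m t].
- rewrite n_eq !in_itv /= => sumE [] [n_range m_range].
    have := gfib_add_neq_exp2 (ltnW k_ge3) n_range m_range.
    by rewrite sumE eqxx.
  have m_in_lt : k%:Z + 2 <= m < t + 2 by lia.
  by have [] := gfib_add_eq_exp2_unique (ltnW k_ge3) n_range m_in_lt sumE; lia.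
- have exp2_gt : s%:Z < 2 ^+ s.
    by rewrite -natz -[2]natz -natrX ltr_nat ltn_expl.
  have m_in : 2 <= m <= k%:Z + 1 by lia.
  have n_in : k%:Z + 2 <= n <= 2 * k%:Z + 2 by lia.
  by split=> //; [exact: gfib_add_eq_exp2_family | lia].
Qed.
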